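(* Let $\Gamma$ be a connected vertex-transitive digraph that has Property Z, and set $G=\mathrm{Aut}(\Gamma)$. Let $\varphi:\Gamma\to\vec{\mathbb Z}$ be a surjective digraph homomorphism and $\Gamma_0=\varphi^{-1}(0)$. Assume that $G_v$ acts quasi-primitively on both $\mathrm{in}(v)$ and $\mathrm{out}(v)$ for some vertex $v$ of $\Gamma$. If the pointwise stabilizer $G_{(\Gamma_0)}$ is non-trivial, then $\Gamma$ is highly-arc-transitive.
   Context: A digraph $\Gamma=(V\Gamma,E\Gamma)$ has vertex set $V\Gamma$ and arc set $E\Gamma\subseteq V\Gamma\times V\Gamma$. It is connected if its underlying undirected graph is connected. For a vertex $v$, $\mathrm{in}(v)=\{u:(u,v)\in E\Gamma\}$ and $\mathrm{out}(v)=\{u:(v,u)\in E\Gamma\}$. A digraph homomorphism is a map of vertex sets sending arcs to arcs (preserving direction). $\vec{\mathbb Z}$ is the digraph with vertex set $\mathbb Z$ and arcs $(i,i+1)$, $i\in\mathbb Z$. A connected digraph $\Gamma$ has Property Z if there is a surjective digraph homomorphism $\Gamma\to\vec{\mathbb Z}$ (such a homomorphism is unique up to adding an integer constant). A $k$-arc is a sequence of vertices $v_0,\dots,v_k$ with $(v_i,v_{i+1})\in E\Gamma$ for $0\le i<k$ (a 0-arc is a vertex). $\Gamma$ is vertex-transitive if $\mathrm{Aut}(\Gamma)$ is transitive on vertices, $k$-arc-transitive if $\mathrm{Aut}(\Gamma)$ is transitive on $k$-arcs, and highly-arc-transitive if it is $k$-arc-transitive for all $k$. $G_v$ is the stabilizer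 of $v$, and $G_{(A)}=\{g\in G: a^g=a\text{ for all }a\in A\}$ is the pointwise stabilizer of a set $A$. A transitive group action is quasi-primitive if every normal subgroup of the group acts either trivially or transitively. *)

(* Defs.v *)
From Stdlib Require Import Relation_Operators.
From HB Require Import structures.
From mathcomp Require Import all_boot all_order all_algebra.
From mathcomp Require Import boolp classical_sets.

Set Implicit Arguments.
Unset Strict Implicit.
Unset Printing Implicit Defensive.

Local Open Scope classical_set_scope.
Local Open Scope group_scope.

(* No finiteness, local finiteness or countability is assumed. *)
Record digraph := Digraph {
  vertex :> Type;
  arc : vertex -> vertex -> Prop }.

Definition digraph_hom (Γ Δ : digraph) (f : Γ -> Δ) : Prop :=
  forall u v : Γ, arc u v -> arc (f u) (f v).

Definition digraph_connected (Γ : digraph) : Prop :=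
  forall u v : Γ, clos_refl_sym_trans Γ (@arc Γ) u v.

Definition in_nbhd (Γ : digraph) (v : Γ) : set Γ := [set u | arc u v].
Definition out_nbhd (Γ : digraph) (v : Γ) : set Γ := [set u | arc v u].

Definition Zline : digraph := @Digraph int (fun i j => j = (i + 1)%R).

Definition surj_hom (Γ Δ : digraph) (f : Γ -> Δ) : Prop :=
  digraph_hom f /\ forall y : Δ, exists x : Γ, f x = y.

(* To be used for connected digraphs. *)
Definition property_Z (Γ : digraph) : Prop :=
  exists φ : Γ -> Zline, surj_hom φ.

Record aut (Γ : digraph) := Aut {
  aut_fun :> Γ -> Γ;
  aut_finv : Γ -> Γ;
  aut_funK : cancel aut_fun aut_finv;
  aut_finvK : cancel aut_finv aut_fun;
  aut_hom : digraph_hom aut_fun;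
  aut_inv_hom : digraph_hom aut_finv }.

Section AutGroup.
Variable Γ : digraph.
Implicit Types g h : aut Γ.

Lemma aut_ext g h : (forall x, g x = h x) -> g = h.
Proof.
case: g h => [f f' fK f'K fh f'h] [k k' kK k'K kh k'h] /= fk.
have efk : f = k by apply/funext.
subst k.
have efk' : f' = k' by apply/funext => x; rewrite -[x in LHS]k'K fK.
by subst k'; congr Aut; apply: Prop_irrelevance.
Qed.

Definition aut_one : aut Γ :=
  @Aut Γ id id (fun=> erefl) (fun=> erefl) (fun _ _ => id) (fun _ _ => id).

(* Automorphisms act on the right, as permutations do in the library:
   (g * h) x = h (g x). *)
Definition aut_mul g h : aut Γ :=
  @Aut Γ (h \o g) (aut_finv g \o aut_finv h)
    (can_comp (aut_funK h) (aut_funK g))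
    (can_comp (aut_finvK g) (aut_finvK h))
    (fun u v uv => aut_hom h (aut_hom g uv))
    (fun u v uv => aut_inv_hom g (aut_inv_hom h uv)).

Definition aut_inv g : aut Γ :=
  @Aut Γ (aut_finv g) g (aut_finvK g) (aut_funK g) (aut_inv_hom g) (aut_hom g).

HB.instance Definition _ := gen_eqMixin (aut Γ).
HB.instance Definition _ := gen_choiceMixin (aut Γ).

Fact aut_mulA : associative aut_mul.
Proof. by move=> f g h; apply: aut_ext. Qed.
Fact aut_mul1 : left_id aut_one aut_mul.
Proof. by move=> f; apply: aut_ext. Qed.
Fact aut_1mul : right_id aut_one aut_mul.
Proof. by move=> f; apply: aut_ext. Qed.
Fact aut_mulV : left_inverse aut_one aut_inv aut_mul.
Proof. by move=> f; apply: aut_ext => x /=; rewrite aut_finvK. Qed.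
Fact aut_Vmul : right_inverse aut_one aut_inv aut_mul.
Proof. by move=> f; apply: aut_ext => x /=; rewrite aut_funK. Qed.

HB.instance Definition _ :=
  isGroup.Build (aut Γ) aut_mulA aut_mul1 aut_1mul aut_mulV aut_Vmul.

End AutGroup.

Section PermutationGroups.
Variable Γ : digraph.
Implicit Types (H N : set (aut Γ)) (A : set Γ) (v : Γ).

Definition stabilizer v : set (aut Γ) := [set g | g v = v].

Definition pointwise_stabilizer A : set (aut Γ) :=
  [set g | forall a, A a -> g a = a].

Definition normal_subgroup N H : Prop :=
  [/\ N `<=` H, group_closed [in N] &
      forall h n, H h -> N n -> N (n ^ h)].

Definition acts_trivially H A : Prop :=
  forall g a, H g -> A a -> g a = a.

Definition acts_transitively H A : Prop :=
  forall a b, A a -> A b -> exists2 g, H g & g a = b.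

(* H is meant to be a subgroup leaving A invariant. *)
Definition acts_quasi_primitively H A : Prop :=
  acts_transitively H A /\
  forall N, normal_subgroup N H -> acts_trivially N A \/ acts_transitively N A.

End PermutationGroups.

Definition vertex_transitive (Γ : digraph) : Prop :=
  acts_transitively [set: aut Γ] [set: Γ].

Definition is_karc (Γ : digraph) (k : nat) (s : 'I_k.+1 -> Γ) : Prop :=
  forall i j : 'I_k.+1, j = i.+1 :> nat -> arc (s i) (s j).

Definition karc_transitive (Γ : digraph) (k : nat) : Prop :=
  forall s t : 'I_k.+1 -> Γ, is_karc s -> is_karc t ->
  exists g : aut Γ, forall i, g (s i) = t i.

Definition highly_arc_transitive (Γ : digraph) : Prop :=
  forall k : nat, karc_transitive Γ k.

(* Main.v *)
(** An automorphism [g] fixing a level pointwise but moving a vertex above it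
    fixes some level [c] pointwise and moves a vertex of level [c + 1].
    The pointwise stabiliser of a level is normal in the stabiliser of each
    of its vertices [v], so by quasi-primitivity it is transitive on [out v].
    An automorphism fixing a level pointwise can be replaced by the identity
    below that level, so the pointwise stabiliser of all levels up to that of
    [v] is still transitive on [out v], and arcs can be matched one vertex
    at a time.  If [g] only moves vertices below, reverse all the arcs. *)
Require Import Defs.
From mathcomp Require Import all_boot all_order all_algebra.
From mathcomp Require Import boolp classical_sets.
From mathcomp Require Import zify.

Set Implicit Arguments.
Unset Strict Implicit.
Unset Printing Implicit Defensive.

Local Open Scope classical_set_scope.

Import Order.TTheory GRing.Theory Num.Theory.

Lemma exists_arc (Γ : digraph) (x y : Γ) :
  digraph_connected Γ -> x <> y -> exists u v : Γ, Defs.arc u v.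
Proof.
move=> conn; elim: (conn x y) => {x y} [x y xy _|//|x y _ IH yx|x y z _ IHxy _ IHyz xz].
- by exists x, y.
- by apply: IH => xy; apply: yx.
- by have [xy|] := pselect (x = y); [apply: IHyz; rewrite -xy | exact: IHxy].
Qed.

(** Along an undirected path from [x] to [y], each arc contributes the same sign on both sides. So
    every automorphism translates the levels of [φ] by a constant. *)
Lemma aut_shift (Γ : digraph) (φ : Γ -> Zline) (g : aut Γ) (x y : Γ) :
  digraph_connected Γ -> digraph_hom φ ->
  (φ (g x) - φ (g y) = (φ x : int) - φ y :> int)%R.
Proof.
move=> conn φhom; elim: (conn x y) => {x y} [x y xy|x|x y _ IH|x y z _ IHxy _ IHyz].
- have := φhom _ _ xy; have := φhom _ _ (aut_hom g xy); rewrite /=; lia.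
- lia.
- lia.
- lia.
Qed.

Section Splice.
Variables (Γ : digraph) (g : aut Γ) (P : Γ -> bool).
Hypothesis Pg : forall x, P (g x) = P x.
Hypothesis fix_boundary :
  forall u v, Defs.arc u v \/ Defs.arc v u -> ~~ P u -> P v -> g u = u.

Let f x := if P x then g x else x.
Let finv x := if P x then aut_finv g x else x.

(** An arc with exactly one end in [P] has its other end fixed by [g], so the spliced map sends it
    where [g] does. All other arcs lie wholly on the side of [g] or wholly on that of the
    identity. *)
Lemma splice_exists :
  exists h : aut Γ, forall x, h x = if P x then g x else x.
Proof.
have Pgi x : P (aut_finv g x) = P x by rewrite -Pg aut_finvK.
have fK : cancel f finv.
  by move=> x; rewrite /f /finv; case Px: (P x); rewrite ?Pg Px ?aut_funK.
have finvK : cancel finv f.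
  by move=> x; rewrite /f /finv; case Px: (P x); rewrite ?Pgi Px ?aut_finvK.
have gi u : g u = u -> aut_finv g u = u by move=> gu; rewrite -[in LHS]gu aut_funK.
have fhom : digraph_hom f.
  move=> u v uv; rewrite /f.
  case: ifP => Pu; case: ifP => Pv //; first exact: aut_hom.
    by rewrite -[v](fix_boundary (or_intror uv)) ?Pv //; exact: aut_hom.
  by rewrite -[u](fix_boundary (or_introl uv)) ?Pu //; exact: aut_hom.
have finvhom : digraph_hom finv.
  move=> u v uv; rewrite /finv.
  case: ifP => Pu; case: ifP => Pv //; first exact: aut_inv_hom.
    rewrite -[v]gi; first exact: aut_inv_hom.
    by apply: fix_boundary (or_intror uv) _ _; rewrite ?Pv.
  rewrite -[u]gi; first exact: aut_inv_hom.
  by apply: fix_boundary (or_introl uv) _ _; rewrite ?Pu.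
by exists (Aut fK finvK fhom finvhom).
Qed.

End Splice.

(** The relation [e] stands for [arc] or its converse, and [lev] for [φ] or
    [- φ] accordingly. *)
Section Levels.
Variables (Γ : digraph) (e : Γ -> Γ -> Prop) (lev : Γ -> int).
Hypothesis arc_e : forall u v, Defs.arc u v -> e u v \/ e v u.
Hypothesis aut_e : forall (g : aut Γ) u v, e u v -> e (g u) (g v).
Hypothesis lev_e : forall u v, e u v -> lev v = (lev u + 1)%R.
Hypothesis lev_aut : forall (g : aut Γ) x y,
  (lev (g x) - lev (g y) = lev x - lev y)%R.
Hypothesis vtrans : vertex_transitive Γ.

Let level (c : int) : set Γ := [set x | lev x = c].

Lemma move_vertex (x y : Γ) : exists g : aut Γ, g x = y.
Proof. by have [g] := @vtrans x y I I; exists g. Qed.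

Lemma level_stabilizer_conj (g h : aut Γ) (v : Γ) :
  pointwise_stabilizer (level (lev v)) g ->
  pointwise_stabilizer (level (lev (h v))) (g ^ h)%g.
Proof.
move=> gfix x lx.
have -> : (g ^ h)%g x = h (g (aut_finv h x)) by [].
rewrite gfix ?aut_finvK //.
have := lev_aut h (aut_finv h x) v; rewrite aut_finvK.
by move: lx; rewrite /level /=; lia.
Qed.

Lemma level_stabilizer_normal (v : Γ) :
  normal_subgroup (pointwise_stabilizer (level (lev v))) (stabilizer v).
Proof.
split=> [g gfix||h n hv nfix].
- exact: gfix.
- split=> [|g h]; first by rewrite inE.
  rewrite !inE => gfix hfix x lx.
  have -> : (g * h^-1)%g x = aut_finv h (g x) by [].
  by rewrite gfix // -[in LHS](hfix x lx) aut_funK.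
- by rewrite -{1}hv; exact: level_stabilizer_conj.
Qed.

(** Conjugating [g] by an automorphism that takes a predecessor of [w] to [v0] gives an element that
    moves an [e]-successor of [v0]. This rules out the trivial action, and the resulting
    transitivity at [v0] is conjugated to every other vertex. *)
Lemma level_stabilizer_trans (v0 : Γ) (g : aut Γ) (c : int) (w : Γ) :
  (exists u, e u w) ->
  acts_quasi_primitively (stabilizer v0) [set u | e v0 u] ->
  pointwise_stabilizer (level c) g -> lev w = (c + 1)%R -> g w <> w ->
  forall v a b, e v a -> e v b ->
  exists2 h, pointwise_stabilizer (level (lev v)) h & h a = b.
Proof.
move=> [u uw] [_ qp] gfix lw gw.
have lu : lev u = c by have := lev_e uw; lia.
have {qp}[triv|trans] := qp _ (level_stabilizer_normal v0).
  have [k ku] := move_vertex u v0.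
  have gk : pointwise_stabilizer (level (lev v0)) (g ^ k)%g.
    by rewrite -ku; apply: level_stabilizer_conj; rewrite lu.
  have kw : e v0 (k w) by rewrite -ku; exact: aut_e.
  have := triv _ _ gk kw.
  have -> : (g ^ k)%g (k w) = k (g (aut_finv k (k w))) by [].
  by rewrite aut_funK => /(can_inj (aut_funK k)).
move=> v a b va vb; have [k kv] := move_vertex v v0.
have [||n nfix nab] := trans (k a) (k b); try by rewrite /= -kv; exact: aut_e.
exists (n ^ k^-1)%g.
  have -> : v = (k^-1)%g v0 by rewrite -kv /= aut_funK.
  exact: level_stabilizer_conj.
have -> : (n ^ k^-1)%g a = aut_finv k (n ((k^-1)^-1%g a)) by [].
by rewrite invgK nab aut_funK.
Qed.

(** Since [e] joins consecutive levels, a vertex not above [v] but adjacent to one above it lies on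
    the level of [v], where [g] is the identity. *)
Lemma lower_levels_stabilizer (v : Γ) (g : aut Γ) :
  pointwise_stabilizer (level (lev v)) g ->
  exists h : aut Γ, forall x,
    h x = if (lev v < lev x)%R then g x else x.
Proof.
move=> gfix; apply: splice_exists => [x|u w uw].
  by have := lev_aut g x v; rewrite (gfix v) // => ?; congr (_ < _)%R; lia.
rewrite -leNgt => lu lw; apply: gfix => /=.
have [/lev_e|/lev_e] : e u w \/ e w u.
- by case: uw => /arc_e; tauto.
- rewrite /level /=; lia.
- rewrite /level /=; lia.
Qed.

Lemma path_transitive :
  (forall v a b, e v a -> e v b ->
     exists2 h, pointwise_stabilizer (level (lev v)) h & h a = b) ->
  forall k (s t : nat -> Γ),
  (forall i, (i < k)%N -> e (s i) (s i.+1)) ->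
  (forall i, (i < k)%N -> e (t i) (t i.+1)) ->
  exists g : aut Γ, forall i, (i <= k)%N -> g (s i) = t i.
Proof.
move=> trans; elim=> [|k IH] s t es et.
  by have [g g0] := move_vertex (s 0) (t 0); exists g => -[].
have [g gst] := IH s t (fun i ik => es i (ltnW ik)) (fun i ik => et i (ltnW ik)).
have gsk : e (t k) (g (s k.+1)) by rewrite -(gst k) //; exact/aut_e/es.
have [n nfix nst] := trans _ _ _ gsk (et k (ltnSn k)).
have [h hE] := lower_levels_stabilizer nfix.
(* The vertices already matched lie on or below the level of [t k], so [h] fixes them. The new
   vertex lies one level higher, where [h] agrees with [n]. *)
have lt i : (i <= k)%N -> (lev (t (k - i)%N) <= lev (t k))%R.
  elim: i => [|i IHi] ik; first by rewrite subn0.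
  have := IHi (ltnW ik); have := et (k - i.+1)%N ltac:(lia).
  by rewrite subnSK // => /lev_e; lia.
exists (g * h)%g => i; have -> : (g * h)%g (s i) = h (g (s i)) by [].
rewrite leq_eqVlt => /orP[/eqP->|ik].
  by rewrite hE (lev_e gsk) ltrDl ltr01.
rewrite (gst i) // hE ltNge; have := lt (k - i)%N (leq_subr _ _).
by rewrite subKn // => ->.
Qed.

(** Climbing from level [c], some level fails to be fixed pointwise, at the latest that of [x]. The
    level just below the first failure is [d]. *)
Lemma first_moved_level (g : aut Γ) (c : int) (x : Γ) :
  pointwise_stabilizer (level c) g -> (c < lev x)%R -> g x <> x ->
  exists d w,
    [/\ pointwise_stabilizer (level d) g, lev w = (d + 1)%R & g w <> w].
Proof.
move=> + cx gx; have [n ln] : exists n : nat, lev x = (c + n.+1%:Z)%R.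
  by exists `|lev x - c|.-1%N; lia.
elim: n c {cx} ln => [|n IH] c ln gfix; first by exists c, x.
have [gfix'|] := pselect (pointwise_stabilizer (level (c + 1)%R) g).
  by apply: (IH (c + 1)%R) => //; lia.
by move=> /existsNP[w] /not_implyP[lw gw]; exists c, w.
Qed.

Lemma path_transitive_of_moved (v0 : Γ) (g : aut Γ) (c : int) (x : Γ) :
  (exists u v, e u v) ->
  acts_quasi_primitively (stabilizer v0) [set u | e v0 u] ->
  pointwise_stabilizer (level c) g -> (c < lev x)%R -> g x <> x ->
  forall k (s t : nat -> Γ),
  (forall i, (i < k)%N -> e (s i) (s i.+1)) ->
  (forall i, (i < k)%N -> e (t i) (t i.+1)) ->
  exists g : aut Γ, forall i, (i <= k)%N -> g (s i) = t i.
Proof.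
move=> [a [b ab]] qp gfix cx gx.
have [d [w [gd lw gw]]] := first_moved_level gfix cx gx.
apply: path_transitive; apply: level_stabilizer_trans qp gd lw gw.
(* By vertex-transitivity, one arc is enough to give every vertex a predecessor. *)
by have [h <-] := move_vertex b w; exists (h a); exact: aut_e.
Qed.

End Levels.

Theorem theorem4 (Γ : digraph) (φ : Γ -> Zline) :
  digraph_connected Γ ->
  vertex_transitive Γ ->
  property_Z Γ ->
  surj_hom φ ->
  (exists v : Γ,
      acts_quasi_primitively (stabilizer v) (in_nbhd v) /\
      acts_quasi_primitively (stabilizer v) (out_nbhd v)) ->
  pointwise_stabilizer (φ @^-1` [set 0%R : int]) <> [set 1%g] ->
  highly_arc_transitive Γ.
Proof.
move=> conn vtrans _ [φhom φsurj] [v0 [qp_in qp_out]] nontriv k s t sarc tarc.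
have [a [b ab]] : exists a b : Γ, Defs.arc a b.
  have [x x0] := φsurj (0%R : int); have [y y1] := φsurj (1%R : int).
  by apply: (@exists_arc _ x y) => // xy; move: y1; rewrite -xy x0.
have [g [gfix [x gx]]] : exists g : aut Γ,
    pointwise_stabilizer (φ @^-1` [set 0%R : int]) g /\ exists x, g x <> x.
  apply: contrapT => none; apply: nontriv; apply/seteqP; split=> [g gfix|g ->//].
  apply: aut_ext => x; apply: contrapT => gx.
  by apply: none; exists g; split => //; exists x.
pose lev x : int := φ x.
have [lx|lx|lx] := ltgtP (lev x) 0%R; last by case: gx; exact: gfix.
(* The moved vertex lies below level 0. Negating the levels puts it above, and [in_nbhd] becomes the
   set of successors for the reversed arcs. *)
- have levN : pointwise_stabilizer [set x | (- lev x)%R = 0%R] g.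
    by move=> y /= ly; apply: gfix; rewrite /= -/(lev y); lia.
  (* The [k]-arcs are read backwards, to be paths for the reversed relation. *)
  pose s' n := s (inord (k - n)); pose t' n := t (inord (k - n)).
  have rev_arc (r : 'I_k.+1 -> Γ) : is_karc r ->
      forall i, (i < k)%N -> Defs.arc (r (inord (k - i.+1))) (r (inord (k - i))).
    by move=> rarc i ik; apply: rarc; rewrite !inordK; lia.
  have [||||||h hst] := @path_transitive_of_moved Γ (fun u v => Defs.arc v u)
      (fun x => - lev x)%R _ _ _ _ vtrans v0 g 0%R x _ qp_in levN _ gx k s' t'
      (rev_arc s sarc) (rev_arc t tarc).
  + by move=> u v; right.
  + by move=> h u v; exact: aut_hom.
  + by move=> u v /φhom /=; rewrite /lev; lia.
  + by move=> h u v; have := aut_shift h u v conn φhom; rewrite /lev; lia.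
  + by exists b, a.
  + lia.
  exists h => i; have := hst (k - i)%N (leq_subr _ _).
  by rewrite /s' /t' subKn ?inord_val // -ltnS.
(* For [n] above [k], [inord] returns a default index, but only indices up to [k] are compared. *)
- pose s' n := s (inord n); pose t' n := t (inord n).
  have path_arc (r : 'I_k.+1 -> Γ) : is_karc r ->
      forall i, (i < k)%N -> Defs.arc (r (inord i)) (r (inord i.+1)).
    by move=> rarc i ik; apply: rarc; rewrite !inordK; lia.
  have [|||||h hst] := @path_transitive_of_moved Γ (@Defs.arc Γ) lev
      _ _ _ _ vtrans v0 g 0%R x _ qp_out gfix lx gx k s' t'
      (path_arc s sarc) (path_arc t tarc).
  + by move=> u v; left.
  + by move=> h u v; exact: aut_hom.
  + by move=> u v /φhom.
  + by move=> h u v; exact: aut_shift.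
  + by exists a, b.
  by exists h => i; have := hst i; rewrite /s' /t' inord_val => -> //; rewrite -ltnS.
Qed.
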